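(* Let $\{a_0,a_1,\ldots\}$ and $\{b_0,b_1,\ldots\}$ be sequences of (complex) numbers such that $a_0=b_0=1$ and such that for all integers $n\ge 0$ $$\sum_{h=0}^{n} a_{n-h}\,b_h=\delta_{0,n},$$ where $\delta_{0,n}$ is $1$ if $n=0$ and $0$ otherwise. Then for every integer $n>0$ both of the following formulas hold: $$b_n=\sum_{c\in\mathcal{C}(n)}\ \prod_{n_i\in c}\left(-a_{n_i}\right),$$ $$b_n=\sum_{p\in\mathcal{P}(n)}\mu(p)\prod_{n_i\in p}\left(-a_{n_i}\right),$$ where $\mathcal{C}(n)$ is the set of all compositions of $n$, $\mathcal{P}(n)$ is the set of all partitions of $n$, $\mu(p)=l(p)!\big/\prod_{j} m_p(j)!$ with $j$ running over the distinct parts of $p$, and products over $n_i\in c$ or $n_i\in p$ are taken over all parts, counted with multiplicity.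
   Context: Let $n$ be a positive integer. A composition $c$ of $n$ is a finite sequence $(n_1,n_2,\ldots,n_{l(c)})$ of positive integers with $\sum_{i=1}^{l(c)} n_i=n$; sequences that differ in the order of their terms are different compositions. The number $l(c)$ is the length of $c$. A partition $p$ of $n$ is a composition $(n_1,\ldots,n_{l(p)})$ of $n$ whose terms (parts) are in weakly decreasing order, $n_i\ge n_{i+1}$; $l(p)$ is its length, i.e. its number of parts counted with repetition. For a positive integer $j$, $m_p(j)$ denotes the multiplicity of $j$ in $p$, i.e. the number of times $j$ appears as a part of $p$. The number $\mu(p)=l(p)!\big/\prod_j m_p(j)!$ (product over the distinct parts $j$ of $p$) is the number of different compositions formed by the same numbers as in the partition $p$. $\mathcal{C}(n)$ and $\mathcal{P}(n)$ denote the set of all compositions and the set of all partitions of $n$, respectively. *)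

(* Defs.v *)
From HB Require Import structures.
From mathcomp Require Import all_boot all_order all_algebra.
From mathcomp Require Import boolp classical_sets functions cardinality fsbigop reals.
From mathcomp Require Import complex.

Set Implicit Arguments.
Unset Strict Implicit.
Unset Printing Implicit Defensive.

Import Order.TTheory GRing.Theory Num.Theory.

Local Open Scope classical_set_scope.
Local Open Scope ring_scope.

Definition compositions (n : nat) : set (seq nat) :=
  [set c | all (leq 1) c /\ sumn c = n].

Definition partitions (n : nat) : set (seq nat) :=
  [set p | compositions n p /\ sorted geq p].

Definition mult (p : seq nat) (j : nat) : nat := count_mem j p.

(* The quotient is taken in the field F, so no truncated division occurs. *)
Definition mu (F : fieldType) (p : seq nat) : F :=
  (size p)`!%:R / \prod_(j <- undup p) (mult p j)`!%:R.

(* A sum \sum_(x \in A) over a classical set is 0 by convention when its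
   support is infinite; the two facts below show that this never occurs in
   sums over compositions n or partitions n. *)
Lemma finite_compositions (n : nat) : finite_set (compositions n).
Proof.
have size_sumn (c : seq nat) : all (leq 1) c -> (size c <= sumn c)%N.
  elim: c => //= k c IH /andP[k0 /IH]; exact: (leq_add k0).
apply: (@sub_finite_set _ _
  ((fun t : n.-bseq 'I_n.+1 => [seq val i | i <- t]) @` setT)).
  move=> c [c0 cn].
  have le_n : all (fun k => k < n.+1)%N c.
    rewrite -cn; elim: c {c0 cn} => //= k c IH; rewrite ltnS leq_addr /=.
    by apply: sub_all IH => x xc; rewrite ltnS (leq_trans _ (leq_addl _ _)).
  have sz : (size (pmap insub c : seq 'I_n.+1) <= n)%N.
    rewrite size_pmap_sub (leq_trans (count_size _ _)) //.
    by rewrite -[leqRHS]cn size_sumn.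
  exists (Bseq sz) => //=.
  rewrite (pmap_filter (@insubK _ _ _)) -[RHS](all_filterP le_n).
  by apply: eq_filter => k; rewrite isSome_insub.
exact/finite_image/finite_finset.
Qed.

Lemma finite_partitions (n : nat) : finite_set (partitions n).
Proof. by apply: sub_finite_set (finite_compositions n) => p []. Qed.

(* Main.v *)
Require Import Defs.
From HB Require Import structures.
From mathcomp Require Import all_boot all_order all_algebra.
From mathcomp Require Import boolp classical_sets functions cardinality fsbigop reals.
From mathcomp Require Import complex.

Set Implicit Arguments.
Unset Strict Implicit.
Unset Printing Implicit Defensive.

Import Order.TTheory GRing.Theory Num.Theory.

Local Open Scope classical_set_scope.
Local Open Scope ring_scope.

(** Splitting off the first part of a composition shows that the sum over
    compositions satisfies the recurrence [b_n = \sum_(k = 1..n) (- a_k) b_(n-k)]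
    that determines [b].  The summand only depends on the multiset of parts, so
    sorting groups the compositions into the rearrangement classes of the
    partitions, and the class of [p] has multinomial cardinality [mu p]. *)

(** Values outside [s] contribute [0! = 1]. This allows the products for [s] and [rem x s] to be
    compared over one index list, even if [x] occurs only once in [s]. *)
Lemma prod_fact_count_sub (T : eqType) (s r : seq T) :
  uniq r -> {subset s <= r} ->
  (\prod_(j <- r) (count_mem j s)`! = \prod_(j <- undup s) (count_mem j s)`!)%N.
Proof.
move=> ur sr; rewrite (bigID (mem s)) /= [X in (_ * X)%N]big1 ?muln1; last first.
  by move=> j /count_memPn ->.
rewrite -big_filter; apply/perm_big/uniq_perm; rewrite ?filter_uniq ?undup_uniq //.
by move=> j; rewrite mem_filter mem_undup; case: (boolP (j \in s)) => // /sr ->.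
Qed.

Lemma prod_fact_count_rem (T : eqType) (s : seq T) (x : T) : x \in s ->
  (\prod_(j <- undup s) (count_mem j s)`! =
   count_mem x s * \prod_(j <- undup (rem x s)) (count_mem j (rem x s))`!)%N.
Proof.
move=> xs; rewrite -(@prod_fact_count_sub _ (rem x s) (undup s)) ?undup_uniq //.
  rewrite !(bigD1_seq x) ?mem_undup ?undup_uniq //= mulnA; congr (_ * _)%N.
    rewrite count_mem_rem eqxx subn1.
    have: (0 < count_mem x s)%N by rewrite -has_count has_pred1.
    by case: (count_mem x s) => // m _; rewrite factS.
  by apply: eq_bigr => j /negPf jx; rewrite count_mem_rem eq_sym jx subn0.
by move=> j /mem_rem; rewrite mem_undup.
Qed.

Lemma sum_count_undup (T : eqType) (s : seq T) :
  (\sum_(x <- undup s) count_mem x s = size s)%N.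
Proof.
rewrite -sum1_size -[RHS]big_undup_iterop_count; apply: eq_bigr => x _.
by rewrite Monoid.iteropE iter_addn_0 mul1n.
Qed.

(** Induction on the size, sorting the rearrangements by their first element [x]: the tail
    rearranges [rem x s], so this class contributes [count_mem x s * (size s - 1)!], and the
    multiplicities add up to [size s]. *)
Lemma size_permutations_multinomial (T : eqType) (s : seq T) :
  (size (permutations s) * \prod_(j <- undup s) (count_mem j s)`! = (size s)`!)%N.
Proof.
have [n] := ubnP (size s); elim: n s => // n IHn [|x0 s] /ltnSE-le_s.
  by rewrite big_nil.
move: le_s; set s' := x0 :: s => le_s.
rewrite (perm_size (permutationsE _)) // size_allpairs_dep sumnE big_map.
(* The leading factor of the factorial becomes a sum of multiplicities, so that both sides match
   term by term in [x]. *)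
rewrite [RHS]factS -[(size s).+1]/(size s') -[X in _ = (X * _)%N](sum_count_undup s').
rewrite !big_distrl.
apply: eq_big_seq => x; rewrite mem_undup => xs.
by rewrite (prod_fact_count_rem xs) [LHS]mulnCA IHn size_rem.
Qed.

(** The field has characteristic zero, so the product of factorials can be cancelled. *)
Lemma mu_permutations (F : numFieldType) (p : seq nat) :
  mu F p = (size (permutations p))%:R.
Proof.
rewrite /mu -size_permutations_multinomial natrM natr_prod mulfK //.
by rewrite prodf_seq_neq0; apply/allP => j _; rewrite pnatr_eq0 -lt0n fact_gt0.
Qed.

Lemma compositions0 : compositions 0 = [set [::]].
Proof.
apply/seteqP; split => [[|k c] //= [/= /andP[k0 _] /eqP]|c ->] //.
by rewrite addn_eq0 eqn0Ngt k0.
Qed.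

Lemma compositions_cons (n k : nat) (c : seq nat) :
  compositions n (k :: c) <-> (0 < k <= n)%N /\ compositions (n - k) c.
Proof.
split=> [[/= /andP[k0 c0] <-]|[/andP[k0 kn] [c0 cn]]].
  by rewrite k0 leq_addr addKn.
by split; rewrite /= ?k0 // cn subnKC.
Qed.

(** The map [(k, c) |-> k :: c] is a bijection onto the compositions of [n]; positivity of [n]
    excludes the empty one. *)
Lemma fsbig_compositions_recl (V : nmodType) (n : nat) (F : seq nat -> V) :
  (0 < n)%N ->
  \sum_(c \in compositions n) F c =
  \sum_(1 <= k < n.+1) \sum_(c \in compositions (n - k)) F (k :: c).
Proof.
move=> n0; rewrite fsbig_finite; last exact: finite_compositions.
under [RHS]eq_bigr do (rewrite fsbig_finite; last exact: finite_compositions).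
rewrite -(big_allpairs_dep (h := fun k c => k :: c)).
apply/perm_big/uniq_perm => //.
  apply: allpairs_uniq_dep => [|k _|]; rewrite ?iota_uniq ?finmap.fset_uniq //.
  by move=> [k c] [l d] _ _ /= [-> ->].
move=> c; rewrite in_fset_set; last exact: finite_compositions.
apply/idP/allpairsPdep => [|[k [d [kn]]]].
  rewrite inE; case: c => [[_ n0'] |k c /compositions_cons[kn ckn]].
    by rewrite -n0' in n0.
  exists k, c; split=> //; first by rewrite mem_index_iota ltnS.
  by rewrite in_fset_set ?inE //; exact: finite_compositions.
rewrite in_fset_set; last exact: finite_compositions.
rewrite mem_index_iota ltnS in kn; rewrite !inE => dkn ->.
exact/compositions_cons.
Qed.

Lemma perm_compositions (n : nat) (c d : seq nat) :
  perm_eq c d -> compositions n c -> compositions n d.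
Proof.
move=> cd [c0 cn]; split; first by rewrite -(perm_all _ cd).
by rewrite -(perm_sumn cd).
Qed.

(** Each composition rearranges exactly one partition, namely its own weakly decreasing sort. *)
Lemma fsbig_compositions_partitions (V : nmodType) (n : nat) (F : seq nat -> V) :
  \sum_(c \in compositions n) F c =
  \sum_(p \in partitions n) \sum_(c <- permutations p) F c.
Proof.
have geq_total : total geq by move=> x y; exact: leq_total.
have geq_trans : transitive geq by move=> y x z yx zy; exact: leq_trans zy yx.
have geq_anti : antisymmetric geq by move=> x y; rewrite andbC => /anti_leq.
rewrite fsbig_finite; last exact: finite_compositions.
rewrite fsbig_finite; last exact: finite_partitions.
rewrite -(big_allpairs_dep (h := fun _ c => c)).
apply/perm_big/uniq_perm => //.
  apply: allpairs_uniq_dep => //; first by move=> p _; exact: permutations_uniq.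
  move=> _ _ /allpairsPdep[p [c [pn cp ->]]] /allpairsPdep[q [d [qn dq ->]]] /= cd.
  subst d; congr existT; move: pn qn cp dq.
  rewrite !in_fset_set; try exact: finite_partitions.
  rewrite !inE !mem_permutations => -[_ sp] [_ sq] cp cq.
  (* Two sorted rearrangements of the same composition coincide, so the classes are disjoint. *)
  apply: (sorted_eq geq_trans geq_anti) sp sq _.
  by rewrite -(permPl cp).
move=> c; rewrite in_fset_set; last exact: finite_compositions.
apply/idP/allpairsPdep => [|[p [d [pn dp ->]]]].
  rewrite inE => cn; exists (sort geq c), c; split => //.
    rewrite in_fset_set; last exact: finite_partitions.
    rewrite inE; split; last exact: sort_sorted.
    by apply: perm_compositions cn; rewrite perm_sym perm_sort.
  by rewrite mem_permutations perm_sym perm_sort.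
move: pn dp; rewrite in_fset_set; last exact: finite_partitions.
rewrite !inE mem_permutations => -[pn _] dp.
by apply: perm_compositions pn; rewrite perm_sym.
Qed.

Theorem theorem1 (R : realType) (a b : nat -> R[i])
    (ha0 : a 0%N = 1) (hb0 : b 0%N = 1)
    (hab : forall n : nat,
       \sum_(0 <= h < n.+1) a (n - h)%N * b h = (n == 0%N)%:R) :
  forall n : nat, (0 < n)%N ->
    b n = \sum_(c \in compositions n) \prod_(k <- c) (- a k) /\
    b n = \sum_(p \in partitions n) mu R[i] p * \prod_(k <- p) (- a k).
Proof.
(* The case [n = 0] is included, with the empty composition giving [1], because the recurrence
   descends to [b 0]. *)
have bE n : b n = \sum_(c \in compositions n) \prod_(k <- c) (- a k).
  have [m] := ubnP n; elim: m n => // m IHm [_|n /ltnSE-le_nm].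
    by rewrite compositions0 fsbig_set1 big_nil.
  rewrite fsbig_compositions_recl //.
  (* Reversing the sum puts [a 0 * b n.+1] first, ready to be split off and solved for [b n.+1]. *)
  have /eqP := hab n.+1; rewrite big_nat_rev /= add0n big_nat_recl //=.
  rewrite subSS subn0 subnn ha0 mul1r addr_eq0 => /eqP ->.
  (* After the shift the first part is [k.+1], leaving a composition of [n - k]. *)
  rewrite [in RHS]big_add1 /= -sumrN; apply: eq_big_nat => k /= kn.
  rewrite !subSS subSn ?leq_subr // subKn // IHm; last exact: leq_ltn_trans (leq_subr _ _) le_nm.
  rewrite -mulNr mulr_fsumr; apply: eq_fsbigr => c _.
  by rewrite big_cons.
move=> n _; split=> //; rewrite bE fsbig_compositions_partitions.
apply: eq_fsbigr => p _; rewrite mu_permutations mulr_natl.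
(* The product is constant on the rearrangements of [p], so the inner sum is a multiple of it. *)
rewrite (eq_big_seq (fun=> \prod_(k <- p) - a k)) => [|c].
  by rewrite [LHS]big_const_seq count_predT iter_addr_0.
by rewrite mem_permutations => cp; exact: perm_big.
Qed.
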